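(* Let $A,B$ be finite-dimensional quantum systems with $\min(d_A,d_B)\ge2$. A bound on the mean energy does not bound the entanglement generation rate: there is a fixed pure state $|\psi\rangle$ of $AB$ such that for every $E_0>0$ and every $R>0$ there exists a Hermitian operator $H$ on $A\otimes B$ with $|\langle\psi|H|\psi\rangle|\le E_0$ and $\Gamma(\psi,H)\ge R$.
   Context: For a pure bipartite state $|\psi\rangle$ and a Hermitian $H$ on $A\otimes B$, $\Gamma(\psi,H):=\frac{d}{dt}E\big(e^{-iHt}|\psi\rangle\langle\psi|e^{iHt}\big)\big|_{t=0}$, where $E$ is the relative entropy of entanglement; on pure states it equals the entanglement entropy $-\mathrm{Tr}(\rho_A\log\rho_A)$, $\rho_A=\mathrm{Tr}_B|\psi\rangle\langle\psi|$. *)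

(* Defs.v *)
From HB Require Import structures.
From mathcomp Require Import all_boot all_order all_algebra.
From mathcomp Require Import complex mxtens.
From mathcomp Require Import all_classical all_reals all_analysis.

Set Implicit Arguments.
Unset Strict Implicit.
Unset Printing Implicit Defensive.

Import Order.TTheory GRing.Theory Num.Theory.
Import numFieldNormedType.Exports.

Local Open Scope complex_scope.
Local Open Scope classical_set_scope.
Local Open Scope sesquilinear_scope.
Local Open Scope ring_scope.

(* States of an n-dimensional system live on C^n: kets are column vectors.
   The composite of systems of dimensions dA and dB is C^(dA * dB), with the
   Kronecker product [*t] of mxtens as tensor product. *)

(* Functional calculus f(A) of a Hermitian matrix: if A = P^-1 diag(l) P with P
   unitary and l real, then f(A) = P^-1 diag(f(l)) P. *)
Definition funmx (R : realType) n (f : R -> R[i]) (A : 'M[R[i]]_n)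
    : 'M[R[i]]_n :=
  invmx (spectralmx A)
    *m diag_mx (map_mx (fun z => f (complex.Re z)) (spectral_diag A))
    *m spectralmx A.

(* Natural logarithm. Since [ln 0 = 0], this is the logarithm on the support,
   extended by 0 on the kernel. *)
Definition logmx (R : realType) n (A : 'M[R[i]]_n) : 'M[R[i]]_n :=
  funmx (fun x => (ln x)%:C) A.

(* e^{-iHt} *)
Definition evolution (R : realType) n (H : 'M[R[i]]_n) (t : R) : 'M[R[i]]_n :=
  funmx (fun x => cos (x * t) -i* sin (x * t)) H.

Definition pure_state (R : realType) n (psi : 'cV[R[i]]_n) : Prop :=
  (psi^t* *m psi) 0 0 = 1.

Definition projector (R : realType) n (psi : 'cV[R[i]]_n) : 'M[R[i]]_n :=
  psi *m psi^t*.

(* In [R[i]], [0 <= z] means that z is real and nonnegative. *)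
Definition density (R : realType) n (rho : 'M[R[i]]_n) : Prop :=
  [/\ rho \is hermsymmx,
      forall v : 'cV[R[i]]_n, 0 <= (v^t* *m rho *m v) 0 0
    & \tr rho = 1].

Definition separable (R : realType) dA dB (sigma : 'M[R[i]]_(dA * dB)) : Prop :=
  exists (m : nat) (p : 'I_m -> R)
    (alpha : 'I_m -> 'M[R[i]]_dA) (beta : 'I_m -> 'M[R[i]]_dB),
  [/\ forall k, 0 <= p k,
      \sum_(k < m) p k = 1,
      forall k, density (alpha k) /\ density (beta k)
    & sigma = \sum_(k < m) (p k)%:C *: (alpha k *t beta k)].

(* S(rho || sigma) = Tr rho (log rho - log sigma) if supp rho is contained in
   supp sigma, and +oo otherwise. The support of a Hermitian matrix is its
   column space, while [%MS] compares row spaces, whence the transposes. *)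
Definition relative_entropy (R : realType) n (rho sigma : 'M[R[i]]_n)
    : \bar R :=
  if (rho^T <= sigma^T)%MS
  then (complex.Re (\tr (rho *m (logmx rho - logmx sigma))))%:E
  else +oo%E.

Definition relative_entropy_of_entanglement (R : realType) dA dB
    (rho : 'M[R[i]]_(dA * dB)) : \bar R :=
  ereal_inf [set relative_entropy rho sigma |
             sigma in [set s | separable s]].

Definition entanglement_along (R : realType) dA dB
    (psi : 'cV[R[i]]_(dA * dB)) (H : 'M[R[i]]_(dA * dB)) (t : R) : R :=
  fine (relative_entropy_of_entanglement
    (evolution H t *m projector psi *m evolution H (- t))).

(* Meaningful only when the derivative exists. *)
Definition entanglement_rate (R : realType) dA dB
    (psi : 'cV[R[i]]_(dA * dB)) (H : 'M[R[i]]_(dA * dB)) : R :=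
  derive1 (entanglement_along psi H) 0.

(* Main.v *)
(** Take psi = cos a |00> + sin a |11> with 0 < sin a < cos a, and let H be w
    times the Pauli matrix sigma_y on span(|00>, |11>). Then exp(-iHt) rotates
    psi to the vector with angle a + w t, the mean energy is 0, and the rate is w
    times the nonzero derivative of the binary entropy of cos^2, so w can be
    chosen to make it as large as we like.

    The entanglement of c |00> + s |11> is at most the binary entropy of
    p = c^2, q = s^2, as p |00><00| + q |11><11| shows. For the converse, let l be
    the eigenvalues of a separable sigma and u, v the coordinates of |00>, |11> in
    its eigenbasis. The pointwise bound
      |c u + s v|^2 ln l <= l (|u|^2 + |v|^2 + 2 g Re(u^* v)) + (terms without l),
      g = c s (ln p - ln q) / (p - q),
    which is tight at p |00><00| + q |11><11|, sums to
      <psi|ln sigma|psi> <= W + p ln p + q ln q - 1,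
    where W = sigma_00,00 + sigma_11,11 + 2 g Re sigma_00,11 is at most 1 by
    positivity of the partial transpose and 0 <= g <= 1. The pointwise bound is the
    positivity of a 2 x 2 matrix of second divided differences of the logarithm: as
    p, q, l are all shifted by t >= 0 its quadratic form decreases to 0, the
    derivative being minus a square. *)

Require Import Defs.
From HB Require Import structures.
From mathcomp Require Import all_boot all_order all_algebra.
From mathcomp Require Import complex mxtens.
From mathcomp Require Import all_classical all_reals all_analysis.
From mathcomp Require Import ring lra.

Import Order.TTheory GRing.Theory Num.Theory.
Import numFieldNormedType.Exports.

Local Open Scope complex_scope.
Local Open Scope classical_set_scope.
Local Open Scope sesquilinear_scope.
Local Open Scope ring_scope.

Set Implicit Arguments.
Unset Strict Implicit.
Unset Printing Implicit Defensive.

(** * Divided differences of the logarithm *)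

Lemma is_derive_ln_shift (R : realType) (p s : R) : 0 < p + s ->
  is_derive s 1 (fun x => ln (p + x)) (p + s)^-1.
Proof.
move=> ps.
have h : is_derive s 1 (fun x : R => p + x) 1.
  by have := is_deriveD (is_derive_cst p s 1) (is_derive_id s 1); rewrite add0r.
have := @is_derive1_comp R (@ln R) (fun x => p + x) s _ _ (is_derive1_ln ps) h.
by rewrite mulr1.
Qed.

Lemma is_derive_inv_shift (R : realType) (p s : R) : 0 < p + s ->
  is_derive s 1 (fun x => (p + x)^-1) (- (p + s) ^- 2).
Proof.
move=> ps.
have h : is_derive s 1 (fun x : R => p + x) 1.
  by have := is_deriveD (is_derive_cst p s 1) (is_derive_id s 1); rewrite add0r.
have := @is_deriveV R (fun x => p + x) s 1 _ (lt0r_neq0 ps) h.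
by rewrite /GRing.scale /= mulr1.
Qed.

Lemma ln_ratio_le (R : realType) (p l : R) : 0 < p -> 0 < l ->
  ln p - ln l <= (p - l) * l^-1.
Proof.
move=> p0 l0; rewrite -ln_div ?posrE//.
have -> : p / l = 1 + (p - l) / l by field; rewrite gt_eqF.
apply: le_ln1Dx; rewrite mulrBl divff ?gt_eqF//.
by rewrite ltrBDr addNr divr_gt0.
Qed.

Lemma cvg_inv_shift (R : realType) (p : R) :
  (p + x)^-1 @[x --> +oo] --> 0.
Proof.
apply/(@gtr0_cvgV0 R R (pinfty_nbhs R) _ (fun x => p + x)).
  near=> x; have : - p < x by near: x; apply: nbhs_pinfty_gt; apply: num_real.
  by lra.
apply/cvgryPge => A; near=> x.
have : A - p <= x by near: x; apply: nbhs_pinfty_ge; apply: num_real.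
by lra.
Unshelve. all: by end_near. Qed.

Lemma cvg_ln_shift (R : realType) (p l : R) :
  ln (p + x) - ln (l + x) @[x --> +oo] --> 0.
Proof.
apply: (@squeeze_cvgr _ _ _ _ (fun x => (p - l) * (p + x)^-1)
   (fun x => (p - l) * (l + x)^-1)).
- near=> x.
  have px : 0 < p + x.
    have : - p < x by near: x; apply: nbhs_pinfty_gt; apply: num_real.
    by lra.
  have lx : 0 < l + x.
    have : - l < x by near: x; apply: nbhs_pinfty_gt; apply: num_real.
    by lra.
  have := ln_ratio_le px lx; have := ln_ratio_le lx px.
  have -> : (p + x) - (l + x) = p - l by ring.
  have -> : (l + x) - (p + x) = - (p - l) by ring.
  by rewrite mulNr => h1 h2; apply/andP; split; lra.
- by rewrite -[X in _ --> X](mulr0 (p - l)); apply: cvgMr; apply: cvg_inv_shift.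
- by rewrite -[X in _ --> X](mulr0 (p - l)); apply: cvgMr; apply: cvg_inv_shift.
Unshelve. all: by end_near. Qed.

(** Shifting [p], [q], [l] by the same [s >= 0] gives a function [F] of [s] with the claimed
    expression as [F 0]. The last hypothesis says that [F] has nonpositive derivative: [P], [Q], [L]
    stand for the shifted arguments, known only through their unchanged differences. Since
    [C + D + E = 0], [F] tends to 0, and a nonincreasing function with limit 0 is nonnegative. *)
Lemma ge0_of_decay (R : realType) (p q l A B C D E : R) :
  0 < p -> 0 < q -> 0 < l -> C + D + E = 0 ->
  (forall P Q L : R, 0 < P -> 0 < Q -> 0 < L -> P - Q = p - q -> L - Q = l - q ->
    - A / P ^+ 2 - B / Q ^+ 2 + C / P + D / Q + E / L <= 0) ->
  0 <= A / p + B / q + C * ln p + D * ln q + E * ln l.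
Proof.
move=> p0 q0 l0 CDE H.
pose F (s : R) := A * (p + s)^-1 + B * (q + s)^-1 + C * ln (p + s)
   + D * ln (q + s) + E * ln (l + s).
have dF (s : R) : 0 <= s -> is_derive s 1 F
   (- A / (p + s) ^+ 2 - B / (q + s) ^+ 2 + C / (p + s) + D / (q + s)
    + E / (l + s)).
  move=> s0.
  have dp := is_derive_ln_shift (ltr_wpDr s0 p0).
  have dq := is_derive_ln_shift (ltr_wpDr s0 q0).
  have dl := is_derive_ln_shift (ltr_wpDr s0 l0).
  have ip := is_derive_inv_shift (ltr_wpDr s0 p0).
  have iq := is_derive_inv_shift (ltr_wpDr s0 q0).
  have -> : F = A \*: (fun x => (p + x)^-1) + B \*: (fun x => (q + x)^-1)
     + C \*: (fun x => ln (p + x)) + D \*: (fun x => ln (q + x))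
     + E \*: (fun x => ln (l + x)) by [].
  apply: is_derive_eq; rewrite /GRing.scale /=.
  by rewrite mulrN mulNr [B * - _]mulrN.
have -> : A / p + B / q + C * ln p + D * ln q + E * ln l = F 0.
  by rewrite /F !addr0.
have lim : F x @[x --> +oo] --> 0.
  (* Each logarithm diverges alone. Eliminating [E] leaves only differences of shifted logarithms,
     which vanish at infinity. *)
  have -> : F = fun s => A * (p + s)^-1 + B * (q + s)^-1
    + C * (ln (p + s) - ln (l + s)) + D * (ln (q + s) - ln (l + s)).
    apply/funext => s; rewrite /F.
    have -> : E = - C - D by lra.
    by ring.
  have -> : 0 = A * 0 + B * 0 + C * 0 + D * 0 :> R by ring.
  by apply: cvgD; [apply: cvgD; [apply: cvgD|]|];
    apply: cvgMr; first [exact: cvg_inv_shift | exact: cvg_ln_shift].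
apply: (cvgr_to_le lim); near=> x.
have x0 : 0 <= x by near: x; apply: nbhs_pinfty_ge; apply: num_real.
apply: (@ler0_derive1_nincry R F 0) => //.
- move=> s; rewrite in_itv /= andbT => s0.
  by case: (dF s (ltW s0)).
- move=> s; rewrite in_itv /= andbT => s0.
  rewrite derive1E; case: (dF s (ltW s0)) => _ ->.
  by apply: H; rewrite ?addr_gt0//; ring.
- apply: derivable_within_continuous => s; rewrite in_itv /= andbT => s0.
  by case: (dF s s0).
Unshelve. all: by end_near. Qed.

(* Right minus left side is the quadratic form in [x * (l - p)], [y * (l - q)]
   whose matrix consists of [- ln[p, p, l]], [- ln[p, q, l]], [- ln[q, q, l]]. *)
Lemma ln_divided_difference_ge0 (R : realType) (p q l x y : R) :
  0 < p -> 0 < q -> 0 < l -> p != q ->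
  (x + y) ^+ 2 * ln l <=
  l * (x ^+ 2 / p + y ^+ 2 / q + 2 * x * y * ((ln p - ln q) / (p - q)))
  + x ^+ 2 * (ln p - 1) + y ^+ 2 * (ln q - 1)
  + 2 * x * y * ((p * ln q - q * ln p) / (p - q)).
Proof.
move=> p0 q0 l0 pq.
have pq0 : p - q != 0 by rewrite subr_eq0.
rewrite -subr_ge0.
have H := @ge0_of_decay R p q l (x ^+ 2 * (l - p)) (y ^+ 2 * (l - q))
  (x ^+ 2 + 2 * x * y * (l - q) / (p - q))
  (y ^+ 2 + 2 * x * y * (p - l) / (p - q)) (- (x + y) ^+ 2) p0 q0 l0.
apply: le_trans (H _ _) _; first by field.
- move=> P Q L P0 Q0 L0 e1 e2.
  have -> : l - q = L - Q by [].
  have -> : l - p = L - P by lra.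
  have -> : p - l = P - L by lra.
  rewrite -e1.
  have PQ : P - Q != 0 by rewrite e1.
  (* With all differences written in the shifted variables, the derivative collapses to minus a
     square over [L]. *)
  have -> : - (x ^+ 2 * (L - P)) / P ^+ 2 - y ^+ 2 * (L - Q) / Q ^+ 2 +
   (x ^+ 2 + 2 * x * y * (L - Q) / (P - Q)) / P +
   (y ^+ 2 + 2 * x * y * (P - L) / (P - Q)) / Q + - (x + y) ^+ 2 / L =
   - ((x * (L - P) / P + y * (L - Q) / Q) ^+ 2 / L).
    by field; rewrite PQ !gt_eqF.
  by rewrite oppr_le0 divr_ge0 ?sqr_ge0 ?ltW.
- rewrite le_eqVlt; apply/orP; left; apply/eqP.
  by field; rewrite pq0 !gt_eqF.
Qed.

(** If [a] were negative, the right side would be at most [a] at [l = 1 + |b| / (- a)], while the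
    left side is nonnegative there. This extracts the leading coefficient in [l] from a bound valid
    for all large [l]. *)
Lemma affine_ge_scale (R : realType) (a b k : R) : 0 <= k ->
  (forall l, 1 <= l -> k * ln l <= l * a + b) -> 0 <= a.
Proof.
move=> k0 H; rewrite leNgt; apply/negP => a0.
pose l := 1 + `|b| / (- a).
have na : 0 < - a by rewrite oppr_gt0.
have l1 : 1 <= l by rewrite lerDl divr_ge0// ltW.
have := le_trans (mulr_ge0 k0 (ln_ge0 l1)) (H l l1).
have -> : l * a = a - `|b| by rewrite /l; field; rewrite lt_eqF.
by have := ler_norm b; lra.
Qed.

Lemma ln_first_divided_difference_ge0 (R : realType) (p q x y : R) :
  0 < p -> 0 < q -> p != q ->
  0 <= x ^+ 2 / p + y ^+ 2 / q + 2 * x * y * ((ln p - ln q) / (p - q)).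
Proof.
move=> p0 q0 pq.
apply: (@affine_ge_scale _ _ (x ^+ 2 * (ln p - 1) + y ^+ 2 * (ln q - 1)
  + 2 * x * y * ((p * ln q - q * ln p) / (p - q))) ((x + y) ^+ 2)).
  exact: sqr_ge0.
move=> l l1; rewrite !addrA; apply: ln_divided_difference_ge0 => //.
exact: lt_le_trans l1.
Qed.

(** Adds the zero eigenvalues. At [l = 0] the support condition [x + y = 0] kills the left side. The
    constant term on the right is then nonnegative: the open bound at [m^-1], multiplied by [m], is
    affine in [m] with that term as slope. *)
Lemma ln_divided_difference_ge0_closed (R : realType) (p q l x y : R) :
  0 < p -> 0 < q -> 0 <= l -> (l = 0 -> x + y = 0) -> p != q ->
  (x + y) ^+ 2 * ln l <=
  l * (x ^+ 2 / p + y ^+ 2 / q + 2 * x * y * ((ln p - ln q) / (p - q)))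
  + x ^+ 2 * (ln p - 1) + y ^+ 2 * (ln q - 1)
  + 2 * x * y * ((p * ln q - q * ln p) / (p - q)).
Proof.
move=> p0 q0; rewrite le_eqVlt => /predU1P[<- /(_ erefl) xy pq|l0 _]; last first.
  exact: ln_divided_difference_ge0.
rewrite xy expr0n mul0r mul0r add0r.
set b := (_ + _).
set a := x ^+ 2 / p + y ^+ 2 / q + 2 * x * y * ((ln p - ln q) / (p - q)).
apply: (@affine_ge_scale _ b a 0 (lexx 0)) => m m1.
have li : 0 < m^-1 by rewrite invr_gt0 (lt_le_trans _ m1).
have := @ln_divided_difference_ge0 R p q m^-1 x y p0 q0 li pq.
rewrite xy expr0n /= mul0r mul0r -/a => h.
have {}h : 0 <= m^-1 * a + b by rewrite /b !addrA.
have m0 : 0 < m by exact: lt_le_trans m1.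
have -> : m * b + a = m * (m^-1 * a + b) by field; rewrite gt_eqF.
by rewrite mulr_ge0// ltW.
Qed.

(** This is the geometric mean of [c ^+ 2] and [s ^+ 2] divided by their logarithmic mean.
    Nonnegativity is monotonicity of [ln]; at [x = c], [y = - s] the first divided difference form
    equals 2 minus twice the ratio, whence the upper bound. *)
Lemma geometric_log_mean (R : realType) (c s : R) : 0 < c -> 0 < s -> c != s ->
  0 <= c * s * ((ln (c ^+ 2) - ln (s ^+ 2)) / (c ^+ 2 - s ^+ 2)) <= 1.
Proof.
move=> c0 s0 cs.
have p0 : 0 < c ^+ 2 by rewrite exprn_gt0.
have q0 : 0 < s ^+ 2 by rewrite exprn_gt0.
have pq : c ^+ 2 != s ^+ 2 by rewrite eqrXn2 ?ltW.
apply/andP; split; last first.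
  have := @ln_first_divided_difference_ge0 R (c ^+ 2) (s ^+ 2) c (- s) p0 q0 pq.
  rewrite sqrrN !divff ?gt_eqF//; lra.
apply: mulr_ge0; first by rewrite mulr_ge0// ltW.
wlog : c s c0 s0 cs p0 q0 pq / c ^+ 2 < s ^+ 2.
  move=> W; have /orP[] : (c ^+ 2 < s ^+ 2) || (s ^+ 2 < c ^+ 2).
    by rewrite -neq_lt.
    exact: W.
  move=> sc; have := W s c s0 c0.
  by rewrite eq_sym cs q0 p0 eq_sym pq sc -mulrNN -invrN !opprB; apply.
move=> lt; rewrite -mulrNN -invrN !opprB ltW// divr_gt0// subr_gt0//.
by rewrite ltr_ln ?posrE.
Qed.

(** * Derivative of the binary entropy along a rotation of the angle *)

Definition binary_entropy_angle (R : realType) (a : R) : R :=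
  - (cos a ^+ 2 * ln (cos a ^+ 2) + sin a ^+ 2 * ln (sin a ^+ 2)).

Lemma is_derive_sqr_ln (R : realType) (f : R -> R) (x df : R) : 0 < f x ->
  is_derive x 1 f df ->
  is_derive x 1 (fun t => f t ^+ 2 * ln (f t ^+ 2))
    (2 * f x * df * (ln (f x ^+ 2) + 1)).
Proof.
move=> f0 fd.
have f20 : 0 < f x ^+ 2 by rewrite exprn_gt0.
have d2 : is_derive x 1 (fun t => f t ^+ 2) (2 * f x * df).
  have := @is_deriveX _ _ f 2 x 1 df fd.
  by rewrite /GRing.scale /= expr1 mulr_natl.
have dl :=
  @is_derive1_comp R (@ln R) (fun t => f t ^+ 2) x _ _ (is_derive1_ln f20) d2.
have := is_deriveM d2 dl; rewrite /GRing.scale /=.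
suff -> : f x ^+ 2 * ((f x ^+ 2)^-1 * (2 * f x * df)) + ln (f x ^+ 2) * (2 * f x * df)
  = 2 * f x * df * (ln (f x ^+ 2) + 1) by [].
by field; rewrite gt_eqF.
Qed.

Lemma is_derive_binary_entropy_angle (R : realType) (a w t : R) :
  0 < cos (a + w * t) -> 0 < sin (a + w * t) ->
  is_derive t 1 (fun t => binary_entropy_angle (a + w * t))
   (w * (2 * cos (a + w * t) * sin (a + w * t) *
      (ln (cos (a + w * t) ^+ 2) - ln (sin (a + w * t) ^+ 2)))).
Proof.
move=> c0 s0.
have da : is_derive t 1 (fun t => a + w * t) w.
  have := is_deriveD (is_derive_cst a t 1) (is_deriveZ w (is_derive_id t 1)).
  by rewrite add0r /GRing.scale /= mulr1.
have dc := @is_derive1_comp R (@cos R) _ _ _ _ (is_derive_cos _) da.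
have ds := @is_derive1_comp R (@sin R) _ _ _ _ (is_derive_sin _) da.
have := is_deriveN (is_deriveD (is_derive_sqr_ln c0 dc) (is_derive_sqr_ln s0 ds)).
rewrite /=.
set x := (X in is_derive _ _ _ X -> _); set y := (X in _ -> is_derive _ _ _ X).
suff -> : x = y by [].
by rewrite /x /y /=; ring.
Qed.

(** * Positive semidefinite matrices and functional calculus *)

Lemma conjC_real (R : realType) (x : R) : (x%:C)^* = x%:C :> R[i].
Proof. exact: conjc_real. Qed.

Lemma trmxC_mul (R : realType) m n p (A : 'M[R[i]]_(m, n)) (B : 'M[R[i]]_(n, p)) :
  (A *m B)^t* = B^t* *m A^t*.
Proof. by rewrite trmx_mul map_mxM. Qed.

Lemma trmxC_tens (R : realType) m n p q (A : 'M[R[i]]_(m, n)) (B : 'M[R[i]]_(p, q)) :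
  (A *t B)^t* = A^t* *t B^t*.
Proof. by rewrite trmx_tens map_mxT. Qed.

Lemma hermsymmxE (R : realType) n (A : 'M[R[i]]_n) :
  (A \is hermsymmx) = (A == A^t*).
Proof. by rewrite is_hermitianmxE expr0 scale1r. Qed.

Lemma normalmx_spectral (R : realType) n (A : 'M[R[i]]_n) : A \is normalmx ->
  spectralmx A *m A = diag_mx (spectral_diag A) *m spectralmx A.
Proof.
move=> /orthomx_spectralP {2}->.
by rewrite -mulmxA mulKVmx ?spectral_unit.
Qed.

(** In the eigenbasis each coordinate of [v] is either zero or belongs to an eigenvalue equal to
    [mu]. Hence [funmx] can be evaluated on known eigenvectors without knowing which basis
    [spectralmx] selects. *)
Lemma funmx_eigenvector (R : realType) n (f : R -> R[i]) (A : 'M[R[i]]_n)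
    (v : 'cV[R[i]]_n) (mu : R[i]) :
  A \is normalmx -> A *m v = mu *: v ->
  funmx f A *m v = f (complex.Re mu) *: v.
Proof.
move=> /normalmx_spectral PA Av; rewrite /funmx.
set P := spectralmx A in PA *; set D := spectral_diag A in PA *.
have DPv : diag_mx D *m (P *m v) = mu *: (P *m v).
  by rewrite mulmxA -PA -mulmxA Av scalemxAr.
rewrite -!mulmxA -[RHS](mulKmx (spectral_unit A)) -/P; congr (_ *m _).
rewrite -scalemxAr; apply/matrixP => k j.
have /matrixP/(_ k j) := DPv.
rewrite !mul_diag_mx !mxE; set z := \sum_(_ < _) _ => E.
have [->|z0] := eqVneq z 0; first by rewrite !mulr0.
by rewrite (mulIf z0 E).
Qed.

Lemma funmx_trmxC (R : realType) n (f : R -> R[i]) (A : 'M[R[i]]_n) :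
  (funmx f A)^t* = funmx (fun x => (f x)^*%C) A.
Proof.
rewrite /funmx invmx_unitary ?spectral_unitarymx// !trmxC_mul trmxCK mulmxA.
congr (_ *m _ *m _).
by apply/matrixP => i j; rewrite !mxE eq_sym rmorphMn /=; case: eqP => [->|_].
Qed.

Lemma evolutionN (R : realType) n (H : 'M[R[i]]_n) (t : R) :
  evolution H (- t) = (evolution H t)^t*.
Proof.
rewrite /evolution funmx_trmxC; congr (funmx _ _); apply/funext => x /=.
by rewrite mulrN cosN sinN.
Qed.

Lemma trace_projector_mul (R : realType) n (psi : 'cV[R[i]]_n) (M : 'M[R[i]]_n) :
  \tr (projector psi *m M) = (psi^t* *m M *m psi) 0 0.
Proof. by rewrite /projector -mulmxA mxtrace_mulC trace_mx11. Qed.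

Lemma projector_hermitian (R : realType) n (psi : 'cV[R[i]]_n) :
  projector psi \is hermsymmx.
Proof. by rewrite hermsymmxE /projector trmxC_mul trmxCK. Qed.

Lemma projector_id (R : realType) n (psi : 'cV[R[i]]_n) :
  pure_state psi -> projector psi *m psi = psi.
Proof.
move=> h; rewrite /projector -mulmxA.
by rewrite [psi^t* *m psi]mx11_scalar h mulmx1.
Qed.

(** [psi] is an eigenvector of its projector for the eigenvalue 1, so the logarithm of the projector
    annihilates it and only the [sigma] term survives. *)
Lemma relative_entropy_pure (R : realType) n (psi : 'cV[R[i]]_n) (sigma : 'M[R[i]]_n) :
  pure_state psi -> ((projector psi)^T <= sigma^T)%MS ->
  relative_entropy (projector psi) sigma =
  (- complex.Re ((psi^t* *m logmx sigma *m psi) 0 0))%:E.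
Proof.
move=> h s; rewrite /relative_entropy s; congr (_%:E).
have L0 : logmx (projector psi) *m psi = 0.
  rewrite (@funmx_eigenvector _ _ _ _ _ 1).
  - by rewrite /= ln1 scale0r.
  - exact/hermitian_normalmx/projector_hermitian.
  - by rewrite scale1r projector_id.
move: (logmx sigma) (logmx _) L0 => L L' L0.
rewrite trace_projector_mul -mulmxA mulmxBl L0 sub0r mulmxN mulmxA mxE.
by case: (_ 0 0).
Qed.

Lemma funmx_form (R : realType) n (f : R -> R[i]) (A : 'M[R[i]]_n) (v w : 'cV[R[i]]_n) :
  (v^t* *m funmx f A *m w) 0 0 =
  \sum_k f (complex.Re (spectral_diag A 0 k)) *
     (((spectralmx A *m v) k 0)^* * (spectralmx A *m w) k 0).
Proof.
rewrite /funmx invmx_unitary ?spectral_unitarymx//.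
rewrite !mulmxA -trmxC_mul -!mulmxA -[_ *m w]/(_ *m w).
set x := _ *m v; set y := _ *m w.
rewrite mul_diag_mx mxE; apply: eq_bigr => k _.
by rewrite !mxE mulrCA.
Qed.

Lemma hermitian_form (R : realType) n (A : 'M[R[i]]_n) (v w : 'cV[R[i]]_n) :
  A \is hermsymmx ->
  (v^t* *m A *m w) 0 0 =
  \sum_k (complex.Re (spectral_diag A 0 k))%:C *
     (((spectralmx A *m v) k 0)^* * (spectralmx A *m w) k 0).
Proof.
move=> hA; rewrite -(@funmx_form _ _ (fun x => x%:C)); congr ((_ *m _ *m _) 0 0).
have /hermitian_normalmx/orthomx_spectralP {1}-> := hA.
rewrite /funmx; congr (_ *m diag_mx _ *m _); apply/matrixP => i k.
rewrite mxE ord1 RRe_real//.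
exact: (mxOverP (hermitian_spectral_diag_real hA)).
Qed.

Lemma spectral_dot (R : realType) n (A : 'M[R[i]]_n) (v w : 'cV[R[i]]_n) :
  (v^t* *m w) 0 0 =
  \sum_k (((spectralmx A *m v) k 0)^* * (spectralmx A *m w) k 0).
Proof.
have U := spectral_unitarymx A; set P := spectralmx A in U *.
have -> : v^t* *m w = (P *m v)^t* *m (P *m w).
  by rewrite trmxC_mul mulmxA mulmxKtV.
by rewrite mxE; apply: eq_bigr => k _; rewrite !mxE.
Qed.

Definition psdmx (R : realType) n (A : 'M[R[i]]_n) : Prop :=
  A \is hermsymmx /\ forall v : 'cV[R[i]]_n, 0 <= (v^t* *m A *m v) 0 0.

Lemma psdmx_gram (R : realType) m n (S : 'M[R[i]]_(m, n)) : psdmx (S^t* *m S).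
Proof.
split; first by rewrite hermsymmxE trmxC_mul trmxCK.
move=> v; have -> : v^t* *m (S^t* *m S) *m v = (S *m v)^t* *m (S *m v).
  by rewrite trmxC_mul !mulmxA.
by rewrite mxE sumr_ge0// => k _; rewrite !mxE mulrC mul_conjC_ge0.
Qed.

Lemma psdmx_spectral_ge0 (R : realType) n (A : 'M[R[i]]_n) k :
  psdmx A -> 0 <= complex.Re (spectral_diag A 0 k).
Proof.
move=> [hA /(_ (invmx (spectralmx A) *m delta_mx k 0))].
rewrite hermitian_form// mulKVmx ?spectral_unit// (bigD1 k)//= big1 ?addr0.
  by rewrite !mxE !eqxx conjC1 !mulr1 ler0c.
by move=> j jk; rewrite !mxE (negbTE jk) mulr0 mulr0.
Qed.

(** [S] is the root of the spectral diagonal times the eigenbasis. Gram form makes positivity pass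
    to tensor products and transposes at once. *)
Lemma psdmxP (R : realType) n (A : 'M[R[i]]_n) :
  psdmx A -> exists S : 'M[R[i]]_n, A = S^t* *m S.
Proof.
move=> pA; have [hA _] := pA.
pose d := \row_k (Num.sqrt (complex.Re (spectral_diag A 0 k)))%:C.
exists (diag_mx d *m spectralmx A).
have /hermitian_normalmx/orthomx_spectralP {1}-> := hA.
rewrite invmx_unitary ?spectral_unitarymx// trmxC_mul -!mulmxA; congr (mulmx _ _).
rewrite mulmxA; congr (mulmx _ _).
have -> : (diag_mx d)^t* = diag_mx d.
  rewrite tr_diag_mx map_diag_mx; congr diag_mx.
  by apply/matrixP => i j; rewrite !mxE; exact: conjC_real.
rewrite mulmx_diag; congr diag_mx; apply/matrixP => i k; rewrite ord1 !mxE.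
rewrite -rmorphM -expr2 sqr_sqrtr ?psdmx_spectral_ge0//.
apply/esym/RRe_real; exact: (mxOverP (hermitian_spectral_diag_real hA)).
Qed.

Lemma psdmx_tens (R : realType) m n (A : 'M[R[i]]_m) (B : 'M[R[i]]_n) :
  psdmx A -> psdmx B -> psdmx (A *t B).
Proof.
move=> /psdmxP[S ->] /psdmxP[T ->].
by rewrite -tensmx_mul -trmxC_tens; exact: psdmx_gram.
Qed.

Lemma psdmx_trmx (R : realType) n (A : 'M[R[i]]_n) : psdmx A -> psdmx A^T.
Proof.
move=> /psdmxP[S ->].
have -> : (S^t* *m S)^T = (map_mx Num.conj S)^t* *m map_mx Num.conj S.
  rewrite trmx_mul; congr (mulmx _ _); apply/matrixP => i j; rewrite !mxE//.
  by rewrite conjCK.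
exact: psdmx_gram.
Qed.

Lemma psdmx_sum (R : realType) n m (p : 'I_m -> R) (A : 'I_m -> 'M[R[i]]_n) :
  (forall k, 0 <= p k) -> (forall k, psdmx (A k)) ->
  psdmx (\sum_k (p k)%:C *: A k).
Proof.
move=> p0 hA; split.
  rewrite hermsymmxE; apply/eqP/matrixP => i j; rewrite !mxE !summxE rmorph_sum.
  apply: eq_bigr => k _; rewrite !mxE rmorphM /=.
  congr (_ * _); first exact/esym/conjC_real.
  by have [+ _] := hA k; rewrite hermsymmxE => /eqP/matrixP/(_ i j); rewrite !mxE.
move=> v; rewrite mulmx_sumr mulmx_suml summxE sumr_ge0// => k _.
rewrite -scalemxAr -scalemxAl mxE mulr_ge0 ?ler0c//.
by have [_] := hA k.
Qed.

Lemma density_psdmx (R : realType) n (A : 'M[R[i]]_n) : density A -> psdmx A.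
Proof. by case. Qed.

Lemma separable_psdmx (R : realType) dA dB (s : 'M[R[i]]_(dA * dB)) :
  @separable R dA dB s -> psdmx s.
Proof.
move=> [m [p [al [be [p0 _ ab ->]]]]]; apply: psdmx_sum => // k.
by have [/density_psdmx a /density_psdmx b] := ab k; apply: psdmx_tens.
Qed.

Lemma psdmx_diag_ge0 (R : realType) n (A : 'M[R[i]]_n) k : psdmx A -> 0 <= A k k.
Proof.
move=> [_ /(_ (delta_mx k 0))].
by rewrite trmx_delta map_delta_mx -rowE -colE !mxE.
Qed.

(** * Bounds over separable states *)

Lemma trmxCB (R : realType) m n (A B : 'M[R[i]]_(m, n)) :
  (A - B)^t* = A^t* - B^t*.
Proof. by apply/matrixP => i j; rewrite !mxE rmorphB. Qed.

Lemma Re_sum (R : realType) (I : finType) (F : I -> R[i]) :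
  complex.Re (\sum_k F k) = \sum_k complex.Re (F k).
Proof. by apply: (big_morph (@complex.Re R) (id1 := 0)) => [[? ?] [? ?]|]. Qed.

Lemma ReD (R : realType) (z w : R[i]) :
  complex.Re (z + w) = complex.Re z + complex.Re w.
Proof. by case: z w => [? ?] [? ?]. Qed.

Lemma Re_realM (R : realType) (x : R) (z : R[i]) :
  complex.Re (x%:C * z) = x * complex.Re z.
Proof. by case: z => a b /=; rewrite mul0r subr0. Qed.

Lemma Im_realM (R : realType) (x : R) (z : R[i]) :
  complex.Im (x%:C * z) = x * complex.Im z.
Proof. by case: z => a b /=; rewrite mul0r addr0. Qed.

Lemma ImD (R : realType) (z w : R[i]) :
  complex.Im (z + w) = complex.Im z + complex.Im w.
Proof. by case: z w => [? ?] [? ?]. Qed.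

Lemma Re_scale_entry (R : realType) m n (x : R) (A : 'M[R[i]]_(m, n)) i j :
  complex.Re ((x%:C *: A) i j) = x * complex.Re (A i j).
Proof. by rewrite mxE Re_realM. Qed.

Lemma Re_conjM (R : realType) (z w : R[i]) :
  complex.Re (z^* * w) =
  complex.Re z * complex.Re w + complex.Im z * complex.Im w.
Proof.
by rewrite -[z^*]/(conjc z); case: z w => [a b] [c d] /=; rewrite mulNr opprK.
Qed.

Lemma delta_mx_form (R : realType) n (A : 'M[R[i]]_n) k l :
  ((delta_mx k 0 : 'cV_n)^t* *m A *m (delta_mx l 0 : 'cV_n)) 0 0 = A k l.
Proof. by rewrite trmx_delta map_delta_mx -rowE -colE !mxE. Qed.

Lemma form_sub (R : realType) n (A : 'M[R[i]]_n) (x y : 'cV[R[i]]_n) :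
  ((x - y)^t* *m A *m (x - y)) 0 0 =
  (x^t* *m A *m x) 0 0 - (x^t* *m A *m y) 0 0
  - ((y^t* *m A *m x) 0 0 - (y^t* *m A *m y) 0 0).
Proof.
have entryB (X Y : 'M[R[i]]_1) : (X - Y) 0 0 = X 0 0 - Y 0 0 by rewrite !mxE.
rewrite trmxCB mulmxBl mulmxBl mulmxBr entryB entryB.
by rewrite mulmxBr entryB.
Qed.

(** Positivity tested on the difference of two basis vectors; the minus sign turns it into an upper
    bound on the off-diagonal entry. *)
Lemma psdmx_offdiag (R : realType) n (A : 'M[R[i]]_n) k l : psdmx A ->
  2 * complex.Re (A k l) <= complex.Re (A k k) + complex.Re (A l l).
Proof.
move=> [hA /(_ (delta_mx k 0 - delta_mx l 0))].
have -> : ((delta_mx k 0 - delta_mx l 0 : 'cV_n)^t* *m A *m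
    (delta_mx k 0 - delta_mx l 0 : 'cV_n)) 0 0 =
    A k k - A k l - (A l k - A l l).
  by rewrite form_sub; do 2?[congr (_ - _)]; exact: delta_mx_form.
have -> : A l k = (A k l)^*.
  by move: hA; rewrite hermsymmxE => /eqP {1}->; rewrite !mxE.
rewrite lecE => /andP[_] /=.
rewrite -[(A k l)^*]/(conjc (A k l)).
case: (A k k) (A k l) (A l l) => [a a'] [b b'] [c c'] /=; lra.
Qed.

Lemma density_diag_le1 (R : realType) n (A : 'M[R[i]]_n) k l : density A ->
  k != l -> complex.Re (A k k) + complex.Re (A l l) <= 1.
Proof.
move=> dA kl; have [_ _ tA] := dA; have pA := density_psdmx dA.
have <- : complex.Re (\tr A) = 1 by rewrite tA.
rewrite /mxtrace Re_sum (bigD1 k)//= (bigD1 l) 1?eq_sym//= addrA lerDl.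
apply: sumr_ge0 => j _; have := psdmx_diag_ge0 j pA.
by rewrite lecE => /andP[].
Qed.

(** For Hermitian [A], the expectation of [|k><k| + |l><l| + g (|k><l| + |l><k|)], an observable
    that reaches [1 + g] on the equal superposition of [k] and [l]. *)
Definition corner_witness (R : realType) n (g : R) (k l : 'I_n) (A : 'M[R[i]]_n) : R :=
  complex.Re (A k k) + complex.Re (A l l) + 2 * g * complex.Re (A k l).

(* The partial transpose of [A *t B] is positive semidefinite, which bounds the
   off-diagonal entry between (i0, j0) and (i1, j1) by the diagonal entries at
   (i0, j1) and (i1, j0). *)
Lemma corner_witness_tens (R : realType) dA dB (A : 'M[R[i]]_dA) (B : 'M[R[i]]_dB)
    (g : R) (i0 i1 : 'I_dA) (j0 j1 : 'I_dB) :
  0 <= g <= 1 -> i0 != i1 -> j0 != j1 -> density A -> density B ->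
  corner_witness g (mxtens_index (i0, j0)) (mxtens_index (i1, j1)) (A *t B) <= 1.
Proof.
move=> /andP[g0 g1] i01 j01 hA hB.
have pA := density_psdmx hA; have pB := density_psdmx hB.
have := psdmx_offdiag (mxtens_index (i0, j1)) (mxtens_index (i1, j0))
  (psdmx_tens pA (psdmx_trmx pB)).
have := density_diag_le1 hA i01; have := density_diag_le1 hB j01.
rewrite /corner_witness !tensmxE !mxE.
have ReP n (X : 'M[R[i]]_n) k : psdmx X ->
    exists2 x, X k k = x%:C & 0 <= x.
  move=> /(psdmx_diag_ge0 k) h; exists (complex.Re (X k k)).
    by apply/esym/RRe_real/ger0_real.
  by move: h; rewrite lecE => /andP[].
have [a0 -> a00] := ReP _ _ i0 pA; have [a1 -> a10] := ReP _ _ i1 pA.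
have [b0 -> b00] := ReP _ _ j0 pB; have [b1 -> b10] := ReP _ _ j1 pB.
rewrite !Re_realM /=.
set z := complex.Re _ => hb ha hz.
have h0 : 0 <= a0 * b1 + a1 * b0 by rewrite addr_ge0// mulr_ge0.
have h1 : 2 * g * z <= a0 * b1 + a1 * b0.
  have [z0|z0] := leP 0 z; last by apply: le_trans h0; nra.
  by apply: le_trans hz; nra.
(* Expanded, this product is the two diagonal entries of the witness plus the right side of [h1]. *)
have h2 : (a0 + a1) * (b0 + b1) <= 1.
  by rewrite -[X in _ <= X]mulr1 ler_pM// addr_ge0.
lra.
Qed.

Lemma corner_witness_separable (R : realType) dA dB (s : 'M[R[i]]_(dA * dB))
    (g : R) (i0 i1 : 'I_dA) (j0 j1 : 'I_dB) :
  0 <= g <= 1 -> i0 != i1 -> j0 != j1 -> @separable R dA dB s ->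
  corner_witness g (mxtens_index (i0, j0)) (mxtens_index (i1, j1)) s <= 1.
Proof.
move=> g01 i01 j01 [m [p [al [be [p0 p1 ab ->]]]]].
set k := mxtens_index _; set l := mxtens_index _.
have -> : corner_witness g k l (\sum_(j < m) (p j)%:C *: (al j *t be j)) =
    \sum_(j < m) p j * corner_witness g k l (al j *t be j).
  rewrite /corner_witness !summxE !Re_sum mulr_sumr -!big_split /=.
  apply: eq_bigr => j _; rewrite !Re_scale_entry; ring.
rewrite -p1; apply: ler_sum => j _; rewrite -[X in _ <= X]mulr1 ler_wpM2l//.
by have [] := ab j; apply: corner_witness_tens.
Qed.


(** The pointwise bound at [c * x m] and [s * y m], summed over the eigenvalues [D m]. Coordinates
    are real here: the lemma serves once for the real and once for the imaginary parts of the
    complex ones. *)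
Lemma sum_ln_le (R : realType) (I : finType) (D x y : I -> R) (c s : R)
    (p := c ^+ 2) (q := s ^+ 2)
    (g := c * s * ((ln p - ln q) / (p - q)))
    (beta := c * s * ((p * ln q - q * ln p) / (p - q))) :
  0 < c -> 0 < s -> c != s -> (forall m, 0 <= D m) ->
  (forall m, D m = 0 -> c * x m + s * y m = 0) ->
  \sum_m ln (D m) * (c * x m + s * y m) ^+ 2 <=
  \sum_m D m * (x m * x m) + \sum_m D m * (y m * y m)
  + 2 * g * \sum_m D m * (x m * y m) + p * (ln p - 1) * \sum_m x m * x m
  + q * (ln q - 1) * \sum_m y m * y m + 2 * beta * \sum_m x m * y m.
Proof.
move=> c0 s0 cs D0 xy.
have p0 : 0 < p by rewrite exprn_gt0.
have q0 : 0 < q by rewrite exprn_gt0.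
have pq : p != q by rewrite eqrXn2 ?ltW.
rewrite !mulr_sumr -!big_split /=; apply: ler_sum => m _.
have := ln_divided_difference_ge0_closed p0 q0 (D0 m) (xy m) pq.
have -> : (c * x m) ^+ 2 / p = x m ^+ 2.
  by rewrite exprMn mulrAC divff ?mul1r ?gt_eqF.
have -> : (s * y m) ^+ 2 / q = y m ^+ 2.
  by rewrite exprMn mulrAC divff ?mul1r ?gt_eqF.
rewrite [ln _ * _]mulrC => h; apply: le_trans h _.
by rewrite /g /beta -/p -/q /p /q le_eqVlt; apply/orP; left; apply/eqP; ring.
Qed.

Lemma sum_Re_conjM (R : realType) (I : finType) (D : I -> R) (u v : I -> R[i]) :
  complex.Re (\sum_m (D m)%:C * ((u m)^* * v m)) =
  \sum_m D m * (complex.Re (u m) * complex.Re (v m)) +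
  \sum_m D m * (complex.Im (u m) * complex.Im (v m)).
Proof.
rewrite Re_sum -big_split /=; apply: eq_bigr => m _.
by rewrite Re_realM Re_conjM mulrDr.
Qed.

Lemma delta_mx_dot (R : realType) n (a b : 'I_n) :
  ((delta_mx a 0 : 'cV[R[i]]_n)^t* *m (delta_mx b 0 : 'cV[R[i]]_n)) 0 0 =
  (a == b)%:R.
Proof. by rewrite -[X in X *m _]mulmx1 delta_mx_form mxE. Qed.

(** Unitarity of the eigenbasis, split into real and imaginary parts to match the two uses of
    [sum_ln_le]. *)
Lemma spectral_delta_dot (R : realType) n (A : 'M[R[i]]_n) (a b : 'I_n)
    (u := fun j m => (spectralmx A *m (delta_mx j 0 : 'cV_n)) m 0) :
  \sum_m complex.Re (u a m) * complex.Re (u b m) +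
  \sum_m complex.Im (u a m) * complex.Im (u b m) = (a == b)%:R.
Proof.
have := congr1 (@complex.Re R) (@spectral_dot _ _ A (delta_mx a 0) (delta_mx b 0)).
rewrite delta_mx_dot Re_sum -big_split /=.
have -> : complex.Re (a == b)%:R = (a == b)%:R :> R by case: (a == b).
by move=> ->; apply: eq_bigr => m _; rewrite Re_conjM.
Qed.

Lemma spectral_delta_form (R : realType) n (A : 'M[R[i]]_n) (a b : 'I_n)
    (u := fun j m => (spectralmx A *m (delta_mx j 0 : 'cV_n)) m 0)
    (D := fun m => complex.Re (spectral_diag A 0 m)) :
  A \is hermsymmx ->
  \sum_m D m * (complex.Re (u a m) * complex.Re (u b m)) +
  \sum_m D m * (complex.Im (u a m) * complex.Im (u b m)) = complex.Re (A a b).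
Proof.
by move=> hA; rewrite -[A a b]delta_mx_form hermitian_form// sum_Re_conjM.
Qed.

Lemma Re_form_ln_le (R : realType) n (sigma : 'M[R[i]]_n) (k l : 'I_n) (c s : R)
    (w : 'cV[R[i]]_n) :
  0 < c -> 0 < s -> c != s -> psdmx sigma -> k != l ->
  let psi := c%:C *: delta_mx k 0 + s%:C *: delta_mx l 0 in
  let g := c * s * ((ln (c ^+ 2) - ln (s ^+ 2)) / (c ^+ 2 - s ^+ 2)) in
  psi = sigma *m w ->
  complex.Re ((psi^t* *m logmx sigma *m psi) 0 0) <=
  corner_witness g k l sigma
  + c ^+ 2 * (ln (c ^+ 2) - 1) + s ^+ 2 * (ln (s ^+ 2) - 1).
Proof.
move=> c0 s0 cs psigma kl psi g psiE.
have [hsigma _] := psigma.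
pose P := spectralmx sigma; pose D m := complex.Re (spectral_diag sigma 0 m).
pose u m := (P *m (delta_mx k 0 : 'cV_n)) m 0.
pose v m := (P *m (delta_mx l 0 : 'cV_n)) m 0.
have Ppsi m : (P *m psi) m 0 = c%:C * u m + s%:C * v m.
  by rewrite /psi mulmxDr -!scalemxAr mxE; congr (_ + _); rewrite mxE.
(* [psi] lies in the range of [sigma], so it has no component along eigenvectors with eigenvalue
   0. *)
have Ppsi0 m : D m = 0 -> c%:C * u m + s%:C * v m = 0.
  move=> Dm; rewrite -Ppsi psiE mulmxA /P normalmx_spectral ?hermitian_normalmx//.
  rewrite -mulmxA mul_diag_mx mxE -[spectral_diag _ 0 m]RRe_real.
    by rewrite -/(D m) Dm mul0r.
  exact: (mxOverP (hermitian_spectral_diag_real hsigma)).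
have D0 m : 0 <= D m by exact: psdmx_spectral_ge0.
have re0 m : D m = 0 -> c * complex.Re (u m) + s * complex.Re (v m) = 0.
  by move=> /Ppsi0 /(congr1 (@complex.Re R)); rewrite ReD !Re_realM.
have im0 m : D m = 0 -> c * complex.Im (u m) + s * complex.Im (v m) = 0.
  by move=> /Ppsi0 /(congr1 (@complex.Im R)); rewrite ImD !Im_realM.
have form_eq : complex.Re ((psi^t* *m logmx sigma *m psi) 0 0) =
    \sum_m ln (D m) * (c * complex.Re (u m) + s * complex.Re (v m)) ^+ 2 +
    \sum_m ln (D m) * (c * complex.Im (u m) + s * complex.Im (v m)) ^+ 2.
  rewrite funmx_form sum_Re_conjM; congr (_ + _); apply: eq_bigr => m _.
    by rewrite Ppsi ReD !Re_realM -expr2.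
  by rewrite Ppsi ImD !Im_realM -expr2.
have := lerD (sum_ln_le c0 s0 cs D0 re0) (sum_ln_le c0 s0 cs D0 im0).
rewrite -form_eq => h; apply: le_trans h _.
(* Adds the real and imaginary bounds: normalization turns the coefficients [P'] and [Q'] into
   constants, and orthogonality removes the cross term [b']. *)
have comb (a1 a2 A b1 b2 B h1 h2 H x1 x2 y1 y2 z1 z2 g' P' Q' b' : R) :
    x1 + x2 = 1 -> y1 + y2 = 1 -> z1 + z2 = 0 ->
    a1 + a2 = A -> b1 + b2 = B -> h1 + h2 = H ->
    a1 + b1 + 2 * g' * h1 + P' * x1 + Q' * y1 + 2 * b' * z1 +
    (a2 + b2 + 2 * g' * h2 + P' * x2 + Q' * y2 + 2 * b' * z2) <=
    A + B + 2 * g' * H + P' + Q'.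
  move=> x y z <- <- <-.
  have -> : x2 = 1 - x1 by rewrite -x; ring.
  have -> : y2 = 1 - y1 by rewrite -y; ring.
  have -> : z2 = - z1 by rewrite -[RHS]add0r -z; ring.
  by rewrite le_eqVlt; apply/orP; left; apply/eqP; ring.
apply: comb.
- by have := spectral_delta_dot sigma k k; rewrite eqxx.
- by have := spectral_delta_dot sigma l l; rewrite eqxx.
- by have := spectral_delta_dot sigma k l; rewrite (negbTE kl).
- exact: spectral_delta_form.
- exact: spectral_delta_form.
- exact: spectral_delta_form.
Qed.

(** * States of a two-dimensional subspace *)

Lemma Re_conj_realM (R : realType) (x : R) (z : R[i]) :
  complex.Re (x%:C^* * z) = x * complex.Re z.
Proof.
have -> : x%:C^* = x%:C :> R[i] by exact: conjC_real.
exact: Re_realM.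
Qed.

Definition two_level (R : realType) n (k l : 'I_n) (a b : R[i]) : 'cV[R[i]]_n :=
  a *: delta_mx k 0 + b *: delta_mx l 0.

Lemma two_levelD (R : realType) n (k l : 'I_n) (a b a' b' : R[i]) :
  two_level k l a b + two_level k l a' b' = two_level k l (a + a') (b + b').
Proof. by rewrite /two_level !scalerDl addrACA. Qed.

Lemma two_levelZ (R : realType) n (k l : 'I_n) (z a b : R[i]) :
  z *: two_level k l a b = two_level k l (z * a) (z * b).
Proof. by rewrite /two_level scalerDr !scalerA. Qed.

Lemma two_level_dot (R : realType) n (k l : 'I_n) (a b a' b' : R[i]) : k != l ->
  ((two_level k l a b)^t* *m two_level k l a' b') 0 0 = a^* * a' + b^* * b'.
Proof.
move=> kl; have lk : l != k by rewrite eq_sym.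
have -> : (two_level k l a b)^t* = a^* *: delta_mx 0 k + b^* *: delta_mx 0 l.
  apply/matrixP => i j; rewrite !mxE rmorphD !rmorphM /= !rmorph_nat.
  by rewrite [(j == k) && _]andbC [(j == l) && _]andbC.
rewrite /two_level mulmxDl !mulmxDr -!scalemxAl -!scalemxAr !mul_delta_mx.
rewrite (mul_delta_mx_0 _ _ _ kl) (mul_delta_mx_0 _ _ _ lk) !scaler0 addr0 add0r.
by rewrite !mxE !eqxx !mulr1.
Qed.

Lemma pure_two_level (R : realType) n (k l : 'I_n) (c s : R) : k != l ->
  c ^+ 2 + s ^+ 2 = 1 -> pure_state (two_level k l c%:C s%:C).
Proof.
move=> kl cs; rewrite /pure_state two_level_dot//.
have -> : c%:C^* = c%:C :> R[i] by exact: conjC_real.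
have -> : s%:C^* = s%:C :> R[i] by exact: conjC_real.
by rewrite -!rmorphM -rmorphD -!expr2 cs rmorph1.
Qed.

(** At [p = c ^+ 2], [q = s ^+ 2] this is the projector on [two_level k l c s] with its coherences
    erased. For the product indices used below it is a closest separable state. *)
Definition two_level_mixture (R : realType) n (k l : 'I_n) (p q : R) : 'M[R[i]]_n :=
  p%:C *: delta_mx k k + q%:C *: delta_mx l l.

Lemma two_level_mixture_mul (R : realType) n (k l : 'I_n) (p q : R) (a b : R[i]) :
  k != l ->
  two_level_mixture k l p q *m two_level k l a b =
  two_level k l (p%:C * a) (q%:C * b).
Proof.
move=> kl; have lk : l != k by rewrite eq_sym.
rewrite /two_level /two_level_mixture.
rewrite mulmxDl !mulmxDr -!scalemxAl -!scalemxAr !mul_delta_mx.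
rewrite (mul_delta_mx_0 _ _ _ kl) (mul_delta_mx_0 _ _ _ lk) !scaler0 addr0 add0r.
by rewrite !scalerA.
Qed.

Lemma two_level_mixture_hermitian (R : realType) n (k l : 'I_n) (p q : R) :
  two_level_mixture k l p q \is hermsymmx.
Proof.
rewrite hermsymmxE; apply/eqP/matrixP => i j; rewrite !mxE rmorphD !rmorphM /=.
rewrite !rmorph_nat [(j == k) && _]andbC [(j == l) && _]andbC.
by congr (_ * _ + _ * _); apply/esym/conjC_real.
Qed.

Lemma logmx_two_level_mixture (R : realType) n (k l : 'I_n) (p q : R) (a b : R[i]) :
  k != l ->
  logmx (two_level_mixture k l p q) *m two_level k l a b =
  two_level k l ((ln p)%:C * a) ((ln q)%:C * b).
Proof.
move=> kl; have N := hermitian_normalmx (two_level_mixture_hermitian k l p q).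
have -> : two_level k l a b = two_level k l a 0 + two_level k l 0 b.
  by rewrite two_levelD addr0 add0r.
rewrite mulmxDr (@funmx_eigenvector _ _ _ _ _ p%:C)//; last first.
  by rewrite two_level_mixture_mul// two_levelZ !mulr0.
rewrite (@funmx_eigenvector _ _ _ _ _ q%:C)//; last first.
  by rewrite two_level_mixture_mul// two_levelZ !mulr0.
by rewrite !two_levelZ two_levelD !mulr0 addr0 add0r.
Qed.

Lemma density_delta (R : realType) n (i : 'I_n) :
  density (delta_mx i i : 'M[R[i]]_n).
Proof.
have [h1 h2] : psdmx (delta_mx i i : 'M[R[i]]_n).
  have -> : delta_mx i i = (delta_mx 0 i : 'rV[R[i]]_n)^t* *m delta_mx 0 i.
    by rewrite trmx_delta map_delta_mx mul_delta_mx.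
  exact: psdmx_gram.
split => //.
rewrite /mxtrace (bigD1 i)//= big1 ?addr0 ?mxE ?eqxx// => j ji.
by rewrite mxE (negbTE ji).
Qed.

Lemma tens_delta_mx (R : realType) dA dB (i i' : 'I_dA) (j j' : 'I_dB) :
  (delta_mx i i' : 'M[R[i]]_dA) *t (delta_mx j j' : 'M[R[i]]_dB) =
  delta_mx (mxtens_index (i, j)) (mxtens_index (i', j')).
Proof.
apply/matrixP => x y.
case: (mxtens_indexP x) => x1 x2; case: (mxtens_indexP y) => y1 y2.
rewrite tensmxE !mxE !(can_eq (@mxtens_indexK _ _)) !xpair_eqE.
by do 4![case: eqP => _]; rewrite /= ?mulr1 ?mulr0 ?mul0r.
Qed.

Lemma separable_two_level_mixture (R : realType) dA dB (i0 i1 : 'I_dA)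
    (j0 j1 : 'I_dB) (p q : R) :
  0 <= p -> 0 <= q -> p + q = 1 ->
  separable (two_level_mixture (mxtens_index (i0, j0)) (mxtens_index (i1, j1)) p q).
Proof.
move=> p0 q0 pq.
exists 2, (fun j : 'I_2 => if j == 0 then p else q),
  (fun j : 'I_2 => if j == 0 then delta_mx i0 i0 else delta_mx i1 i1),
  (fun j : 'I_2 => if j == 0 then delta_mx j0 j0 else delta_mx j1 j1).
split.
- by move=> j; case: ifP.
- by rewrite big_ord_recl big_ord1.
- by move=> j; case: ifP => _; split; apply: density_delta.
- by rewrite big_ord_recl big_ord1 /= !tens_delta_mx.
Qed.

Lemma relative_entropy_two_level_mixture (R : realType) n (k l : 'I_n) (c s : R) :
  0 < c -> 0 < s -> k != l -> c ^+ 2 + s ^+ 2 = 1 ->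
  relative_entropy (projector (two_level k l c%:C s%:C))
    (two_level_mixture k l (c ^+ 2) (s ^+ 2)) =
  (- (c ^+ 2 * ln (c ^+ 2) + s ^+ 2 * ln (s ^+ 2)))%:E.
Proof.
move=> c0 s0 kl cs; rewrite relative_entropy_pure; last 2 first.
- exact: pure_two_level.
- set M := two_level_mixture _ _ _ _; set psi := two_level _ _ _ _.
  (* Support condition: the mixture scales the coordinates by [c ^+ 2] and [s ^+ 2], so the preimage
     of [psi] has coordinates [c^-1] and [s^-1]. *)
  have psiE : psi = M *m two_level k l (c^-1)%:C (s^-1)%:C.
    rewrite /psi /M (two_level_mixture_mul _ _ _ _ kl).
    by congr two_level; rewrite -rmorphM; congr (_%:C); rewrite expr2 mulfK ?gt_eqF.
  have -> : projector psi = M *m (two_level k l (c^-1)%:C (s^-1)%:C *m psi^t*).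
    by rewrite /projector mulmxA -psiE.
  by rewrite trmx_mul; exact: submxMl.
rewrite -mulmxA logmx_two_level_mixture// two_level_dot// ReD.
by congr ((- (_ + _))%:E); rewrite Re_conj_realM Re_realM /=; ring.
Qed.

Lemma relative_entropy_separable_ge (R : realType) dA dB (i0 i1 : 'I_dA)
    (j0 j1 : 'I_dB) (c s : R) (sigma : 'M[R[i]]_(dA * dB)) :
  0 < c -> 0 < s -> c != s -> i0 != i1 -> j0 != j1 -> c ^+ 2 + s ^+ 2 = 1 ->
  @separable R dA dB sigma ->
  ((- (c ^+ 2 * ln (c ^+ 2) + s ^+ 2 * ln (s ^+ 2)))%:E <=
  relative_entropy (projector (two_level (mxtens_index (i0, j0))
    (mxtens_index (i1, j1)) c%:C s%:C)) sigma)%E.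
Proof.
move=> c0 s0 cs i01 j01 cs1 hsep.
have kl : mxtens_index (i0, j0) != mxtens_index (i1, j1).
  by rewrite (can_eq (@mxtens_indexK _ _)) xpair_eqE (negbTE i01).
have pure := pure_two_level kl cs1.
set psi := two_level _ _ _ _ in pure *.
have [supp|nsupp] := boolP ((projector psi)^T <= sigma^T)%MS; last first.
  by rewrite /relative_entropy (negbTE nsupp) leey.
rewrite relative_entropy_pure// lee_fin lerN2.
(* The inclusion of supports is turned into an explicit preimage of [psi] under [sigma]. *)
have [X XE] := submxP supp.
have proj_eq : projector psi = sigma *m X^T.
  apply/matrixP => i j; have := congr1 (fun M : 'M[R[i]]_(dA * dB) => M j i) XE.
  rewrite mxE => ->; rewrite !mxE; apply: eq_bigr => m _.
  by rewrite !mxE mulrC.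
have psiE : psi = sigma *m (X^T *m psi).
  by rewrite mulmxA -proj_eq projector_id.
have := Re_form_ln_le c0 s0 cs (separable_psdmx hsep) kl psiE.
rewrite -/psi => h; apply: le_trans h _.
(* The only use of separability beyond positivity: the witness is at most 1, which the remaining
   [- (p + q) = - 1] cancels exactly. *)
have := corner_witness_separable (geometric_log_mean c0 s0 cs) i01 j01 hsep.
move: (corner_witness _ _ _ _) => W hW.
rewrite !mulrBr !mulr1.
move: (c ^+ 2) (s ^+ 2) cs1 => p q pq; move: (p * ln p) (q * ln q) => x y; lra.
Qed.

Lemma relative_entropy_of_entanglement_two_level (R : realType) dA dB
    (i0 i1 : 'I_dA) (j0 j1 : 'I_dB) (c s : R) :
  0 < c -> 0 < s -> c != s -> i0 != i1 -> j0 != j1 -> c ^+ 2 + s ^+ 2 = 1 ->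
  @relative_entropy_of_entanglement R dA dB
    (projector (two_level (mxtens_index (i0, j0)) (mxtens_index (i1, j1)) c%:C s%:C)) =
  (- (c ^+ 2 * ln (c ^+ 2) + s ^+ 2 * ln (s ^+ 2)))%:E.
Proof.
move=> c0 s0 cs i01 j01 cs1; apply/eqP; rewrite eq_le; apply/andP; split.
  apply: ereal_inf_lbound.
  exists (two_level_mixture (mxtens_index (i0, j0)) (mxtens_index (i1, j1))
    (c ^+ 2) (s ^+ 2)).
    by apply: separable_two_level_mixture; rewrite ?sqr_ge0.
  apply: relative_entropy_two_level_mixture => //.
  by rewrite (can_eq (@mxtens_indexK _ _)) xpair_eqE (negbTE i01).
apply: le_ereal_inf_tmp => _ [sigma hsep <-].
exact: relative_entropy_separable_ge.
Qed.

(** * Rotation of the two-level state and the resulting entanglement rate *)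

Definition rotation_hamiltonian (R : realType) n (k l : 'I_n) (w : R) : 'M[R[i]]_n :=
  (0 -i* w) *: delta_mx k l + (0 +i* w) *: delta_mx l k.

Lemma rotation_hamiltonian_mul (R : realType) n (k l : 'I_n) (w : R) (a b : R[i]) :
  k != l ->
  rotation_hamiltonian k l w *m two_level k l a b =
  two_level k l ((0 -i* w) * b) ((0 +i* w) * a).
Proof.
move=> kl; have lk : l != k by rewrite eq_sym.
rewrite /two_level /rotation_hamiltonian.
rewrite mulmxDl !mulmxDr -!scalemxAl -!scalemxAr !mul_delta_mx.
rewrite (mul_delta_mx_0 _ _ _ kl) (mul_delta_mx_0 _ _ _ lk) !scaler0 addr0 add0r.
by rewrite !scalerA.
Qed.

Lemma rotation_hamiltonian_hermitian (R : realType) n (k l : 'I_n) (w : R) :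
  rotation_hamiltonian k l w \is hermsymmx.
Proof.
rewrite hermsymmxE; apply/eqP/matrixP => i j; rewrite !mxE rmorphD !rmorphM /=.
rewrite !rmorph_nat [(j == k) && _]andbC [(j == l) && _]andbC addrC.
have conjE (x y : R) : (x +i* y)^* = x -i* y by [].
by congr (_ * _ + _ * _); rewrite conjE ?opprK.
Qed.

Lemma evolution_rotation (R : realType) n (k l : 'I_n) (w a t : R) : k != l ->
  evolution (rotation_hamiltonian k l w) t *m
    two_level k l (cos a)%:C (sin a)%:C =
  two_level k l (cos (a + w * t))%:C (sin (a + w * t))%:C.
Proof.
move=> kl.
have N := hermitian_normalmx (rotation_hamiltonian_hermitian k l w).
have evp : rotation_hamiltonian k l w *m two_level k l 1 (0 +i* 1) =
    w%:C *: two_level k l 1 (0 +i* 1).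
  rewrite (rotation_hamiltonian_mul _ _ _ kl) two_levelZ; congr two_level.
    by apply/eqP; rewrite eq_complex /=; apply/andP; split; apply/eqP; ring.
  by apply/eqP; rewrite eq_complex /=; apply/andP; split; apply/eqP; ring.
have evm : rotation_hamiltonian k l w *m two_level k l 1 (0 -i* 1) =
    (- w)%:C *: two_level k l 1 (0 -i* 1).
  rewrite (rotation_hamiltonian_mul _ _ _ kl) two_levelZ; congr two_level.
    by apply/eqP; rewrite eq_complex /=; apply/andP; split; apply/eqP; ring.
  by apply/eqP; rewrite eq_complex /=; apply/andP; split; apply/eqP; ring.
(* Expansion in the eigenvectors [(1, i)] and [(1, -i)] of eigenvalues [w] and [- w], with
   coefficients [e^(-ia) / 2] and [e^(ia) / 2]; the phases acquired in time [t] replace [a] by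
   [a + w * t]. *)
have -> : two_level k l (cos a)%:C (sin a)%:C =
   (cos a / 2 -i* (sin a / 2)) *: two_level k l 1 (0 +i* 1) +
   (cos a / 2 +i* (sin a / 2)) *: two_level k l 1 (0 -i* 1).
  rewrite !two_levelZ two_levelD; congr two_level.
    by apply/eqP; rewrite eq_complex /=; apply/andP; split; apply/eqP; field.
  by apply/eqP; rewrite eq_complex /=; apply/andP; split; apply/eqP; field.
rewrite mulmxDr -scalemxAr -[X in _ + X]scalemxAr.
rewrite (funmx_eigenvector _ N evp) (funmx_eigenvector _ N evm) /=.
rewrite !two_levelZ two_levelD mulNr cosN sinN cosD sinD.
congr two_level.
  by apply/eqP; rewrite eq_complex /=; apply/andP; split; apply/eqP; field.
by apply/eqP; rewrite eq_complex /=; apply/andP; split; apply/eqP; field.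
Qed.

Lemma rotation_mean_energy (R : realType) n (k l : 'I_n) (w c s : R) : k != l ->
  ((two_level k l c%:C s%:C)^t* *m rotation_hamiltonian k l w *m
    two_level k l c%:C s%:C) 0 0 = 0.
Proof.
move=> kl.
rewrite -mulmxA (rotation_hamiltonian_mul _ _ _ kl) (two_level_dot _ _ _ _ kl).
have -> : c%:C^* = c%:C :> R[i] by exact: conjC_real.
have -> : s%:C^* = s%:C :> R[i] by exact: conjC_real.
by apply/eqP; rewrite eq_complex /=; apply/andP; split; apply/eqP; ring.
Qed.

(** The evolved projector is the projector on the rotated vector, and the angle condition makes its
    amplitudes positive and distinct, as the closed formula requires. *)
Lemma entanglement_along_rotation (R : realType) dA dB (i0 i1 : 'I_dA)
    (j0 j1 : 'I_dB) (w a t : R)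
    (k := mxtens_index (i0, j0)) (l := mxtens_index (i1, j1)) :
  i0 != i1 -> j0 != j1 -> 0 < sin (a + w * t) < cos (a + w * t) ->
  @entanglement_along R dA dB (two_level k l (cos a)%:C (sin a)%:C)
    (rotation_hamiltonian k l w) t =
  binary_entropy_angle (a + w * t).
Proof.
move=> i01 j01 /andP[s0 sc].
have kl : k != l by rewrite (can_eq (@mxtens_indexK _ _)) xpair_eqE (negbTE i01).
rewrite /entanglement_along evolutionN.
have -> (psi : 'cV[R[i]]_(dA * dB)) U :
    U *m projector psi *m U^t* = projector (U *m psi).
  by rewrite /projector trmxC_mul !mulmxA.
rewrite (evolution_rotation _ _ _ kl).
by rewrite relative_entropy_of_entanglement_two_level// ?cos2Dsin2//
  ?(lt_trans s0 sc)// gt_eqF.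
Qed.

(** By continuity the closed formula holds on a neighborhood of time 0, which suffices for the
    derivative there. *)
Lemma near_lt_sin_cos (R : realType) (a w : R) : 0 < sin a < cos a ->
  \forall t \near (0 : R), 0 < sin (a + w * t) < cos (a + w * t).
Proof.
move=> /andP[s0 sc].
have da : is_derive (0 : R) 1 (fun t => a + w * t) w.
  have := is_deriveD (is_derive_cst a (0 : R) 1) (is_deriveZ w (is_derive_id (0 : R) 1)).
  by rewrite add0r /GRing.scale /= mulr1.
have dc := @is_derive1_comp R (@cos R) _ _ _ _ (is_derive_cos _) da.
have ds := @is_derive1_comp R (@sin R) _ _ _ _ (is_derive_sin _) da.
have cc :=
  differentiable_continuous (iffLR (derivable1_diffP _ _) (@ex_derive _ _ _ _ _ _ _ dc)).
have cs :=
  differentiable_continuous (iffLR (derivable1_diffP _ _) (@ex_derive _ _ _ _ _ _ _ ds)).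
have cd : cos (a + w * t) - sin (a + w * t) @[t --> (0 : R)] -->
    cos (a + w * 0) - sin (a + w * 0) by exact: cvgB.
near=> t; apply/andP; split.
  by near: t; apply: (cvgr_gt _ cs); rewrite /= mulr0 addr0.
rewrite -subr_gt0; near: t; apply: (cvgr_gt _ cd).
by rewrite /= mulr0 addr0 subr_gt0.
Unshelve. all: by end_near. Qed.

Lemma sin_lt_cos_pi8 (R : realType) : 0 < sin (pi / 8 : R) < cos (pi / 8 : R).
Proof.
have p0 := @pi_gt0 R.
have s0 : 0 < sin (pi / 8 : R) by apply: sin_gt0_pihalf; apply/andP; split; lra.
have c0 : 0 < cos (pi / 8 : R) by apply: cos_gt0_pihalf; apply/andP; split; lra.
rewrite s0 /= -(ltr_pXn2r (n := 2))// ?nnegrE ?ltW//.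
(* The double angle formula identifies this cosine with the difference of the two squares. *)
have : 0 < cos (pi / 4 : R) by apply: cos_gt0_pihalf; apply/andP; split; lra.
have -> : pi / 4 = pi / 8 + pi / 8 :> R by field.
by rewrite cosD -!expr2 subr_gt0.
Qed.

Unset Implicit Arguments.
Set Strict Implicit.

Theorem mainTheorem5 (R : realType) (dA dB : nat) (hd : (2 <= minn dA dB)%N) :
  exists psi : 'cV[R[i]]_(dA * dB),
    pure_state psi /\
    forall E0 r : R, 0 < E0 -> 0 < r ->
    exists H : 'M[R[i]]_(dA * dB),
      [/\ H \is hermsymmx,
          `|(psi^t* *m H *m psi) 0 0| <= E0%:C,
          derivable (entanglement_along psi H) 0 1
        & r <= entanglement_rate psi H].
Proof.
move: hd; rewrite leq_min => /andP[hA hB].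
pose i0 := Ordinal (ltnW hA); pose i1 := Ordinal hA.
pose j0 := Ordinal (ltnW hB); pose j1 := Ordinal hB.
have i01 : i0 != i1 by [].
have j01 : j0 != j1 by [].
pose k := mxtens_index (i0, j0); pose l := mxtens_index (i1, j1).
have kl : k != l by rewrite (can_eq (@mxtens_indexK _ _)) xpair_eqE (negbTE i01).
pose a : R := pi / 8; have sc := sin_lt_cos_pi8 R.
have [s0 lt_sc] := andP sc; have c0 := lt_trans s0 lt_sc.
exists (two_level k l (cos a)%:C (sin a)%:C).
split; first by apply: pure_two_level; rewrite ?cos2Dsin2.
move=> E0 r E00 r0.
(* Derivative of the entropy in the angle at [a]; it does not depend on [r], so [w = r / slope]
   makes the rate exactly [r]. *)
pose slope := 2 * cos a * sin a * (ln (cos a ^+ 2) - ln (sin a ^+ 2)).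
have slope0 : 0 < slope.
  apply: mulr_gt0; first by rewrite !mulr_gt0.
  by rewrite subr_gt0 ltr_ln ?posrE ?exprn_gt0// ltr_pXn2r ?nnegrE ?ltW.
pose w := r / slope.
exists (rotation_hamiltonian k l w).
have rate : is_derive (0 : R) 1 (@entanglement_along R dA dB
    (two_level k l (cos a)%:C (sin a)%:C) (rotation_hamiltonian k l w)) r.
  have a0 : a + w * 0 = a by rewrite mulr0 addr0.
  have := @is_derive_binary_entropy_angle R a w 0; rewrite a0 => /(_ c0 s0).
  rewrite -/slope /w divfK ?gt_eqF//; apply: near_eq_is_derive.
  apply: filterS (near_lt_sin_cos w sc) => t ht.
  by rewrite (entanglement_along_rotation i01 j01 ht).
split.
- exact: rotation_hamiltonian_hermitian.
(* The mean energy vanishes for every [w], so no bound [E0] restricts the speed of rotation. *)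
- by rewrite (rotation_mean_energy _ _ _ kl) normr0 ler0c ltW.
- exact: ex_derive.
- by rewrite /entanglement_rate derive1E (@derive_val _ _ _ _ _ _ _ rate).
Qed.
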